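(* Let $\mathcal H$ be a real Hilbert space, $f:\mathcal H\to\mathbb R$ convex and twice continuously differentiable, with $L$-Lipschitz continuous Hessian for some $L>0$, and assume that $f$ has a minimizer. Let $x_0\in\mathcal H$, $0<\sigma_\ell<\sigma_u<1$, assume that $$\mathcal D_0=\sup\{\|y-x\|:\ \max\{f(x),f(y)\}\le f(x_0)\}<\infty,$$ and let $\{x_k\}$ be an infinite sequence generated by Algorithm 2 (defined in the context). Let $\bar x$ be a minimizer of $f$ and, for a given tolerance $\varepsilon>0$, define $$\kappa_0=\sqrt{\frac{2\sigma_\ell(1-\sigma_u)}{L\mathcal D_0^3}},\qquad K=\frac{2+3\kappa_0\sqrt{f(x_0)-f(\bar x)}}{\kappa_0\sqrt\varepsilon},\qquad J=\frac{2L^{1/6}\left(2+3\kappa_0\sqrt{f(x_0)-f(\bar x)}\right)^{2/3}}{\left[2\sigma_\ell(1-\sigma_u)\right]^{1/6}\kappa_0^{2/3}\sqrt\varepsilon}.$$ Then: (a) for any $k\ge K$, $f(x_k)-f(\bar x)\le\varepsilon$; (b) there exists $j\le2\lceil J\rceil$ such that $\|\nabla f(x_j)\|\le\varepsilon$.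
   Context: The Hessian is $L$-Lipschitz continuous: $\|\nabla^2f(x)-\nabla^2f(y)\|\le L\|x-y\|$ for all $x,y\in\mathcal H$, with the operator norm on the left. Algorithm 2 (proximal-Newton method): given $x_0\in\mathcal H$ and $0<\sigma_\ell<\sigma_u<1$, at each iteration $k=1,2,\dots$: if $\nabla f(x_{k-1})=0$, stop; otherwise compute $\lambda_k>0$ such that $$\frac{2\sigma_\ell}{L}\le\lambda_k\|(I+\lambda_k\nabla^2f(x_{k-1}))^{-1}\lambda_k\nabla f(x_{k-1})\|\le\frac{2\sigma_u}{L},$$ and set $x_k=x_{k-1}-(I+\lambda_k\nabla^2f(x_{k-1}))^{-1}\lambda_k\nabla f(x_{k-1})$. The sequence being infinite means that $\nabla f(x_k)\ne0$ for all $k\ge0$. *)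

(* Defs.v *)
From HB Require Import structures.
From mathcomp Require Import all_boot all_order all_algebra.
From mathcomp Require Import sesquilinear.
From mathcomp Require Import all_classical all_reals all_analysis.

Set Implicit Arguments.
Unset Strict Implicit.
Unset Printing Implicit Defensive.

Import Order.TTheory GRing.Theory Num.Theory.
Import numFieldNormedType.Exports.

Local Open Scope classical_set_scope.
Local Open Scope ring_scope.

Section Hilbert.
Context {R : realType} {H : completeNormedModType R}.
Variable dot : {dot H for @idfun R}.

Definition hilbert_norm : Prop := forall u : H, `|u| ^+ 2 = dot u u.

(* The Riesz representative of the Frechet derivative; it exists whenever
   [f] is differentiable at [x] and [hilbert_norm] holds. *)
Definition gradient (f : H -> R) (x : H) : H :=
  get [set g : H | forall h : H, 'd f x h = dot g h].

Definition hessian (f : H -> R) (x : H) : {linear H -> H} :=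
  'd (gradient f) x.

(* Meaningful for bounded operators only: [sup] is 0 on an unbounded set. *)
Definition opnorm (T : H -> H) : R :=
  sup [set `|T v| | v in [set v : H | `|v| <= 1]].

Definition twice_continuously_differentiable (f : H -> R) : Prop :=
  [/\ forall x, differentiable f x,
      forall x, differentiable (gradient f) x &
      forall x, opnorm (hessian f y \- hessian f x) @[y --> x] --> (0 : R)].

Definition lipschitz_hessian (L : R) (f : H -> R) : Prop :=
  forall x y : H, opnorm (hessian f x \- hessian f y) <= L * `|x - y|.

Definition minimizer (f : H -> R) (z : H) : Prop := forall y : H, f z <= f y.

Definition sublevel_diam (f : H -> R) (x0 : H) : \bar R :=
  ereal_sup [set `|p.2 - p.1|%:E |
             p in [set p : H * H | Num.max (f p.1) (f p.2) <= f x0]].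

(* [(I + lam * hessian f x)^-1 (lam * gradient f x)]. The library's ['pinv_]
   is the inverse of an arbitrary function wherever that function is
   injective; for [f] convex and twice differentiable and [0 < lam],
   the operator is bijective. *)
Definition newton_step (f : H -> R) (lam : R) (x : H) : H :=
  'pinv_(fun=> 0) [set: H] (fun v : H => v + lam *: hessian f x v)
    (lam *: gradient f x).

(* An infinite run: the stopping test [gradient f (x k) = 0] never succeeds.
   Iteration k.+1 goes from [x k] to [x k.+1] using [lam k.+1]; [lam 0] is
   unused. *)
Definition prox_newton_run (f : H -> R) (L sigma_l sigma_u : R) (x0 : H)
    (lam : nat -> R) (x : nat -> H) : Prop :=
  x 0%N = x0 /\
  forall k : nat,
    [/\ gradient f (x k) <> 0,
        0 < lam k.+1,
        2 * sigma_l / L <= lam k.+1 * `|newton_step f (lam k.+1) (x k)|,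
        lam k.+1 * `|newton_step f (lam k.+1) (x k)| <= 2 * sigma_u / L &
        x k.+1 = x k - newton_step f (lam k.+1) (x k)].

End Hilbert.

(* Main.v *)
Require Import Defs.
From HB Require Import structures.
From mathcomp Require Import all_boot all_order all_algebra.
From mathcomp Require Import sesquilinear.
From mathcomp Require Import ring lra.
From mathcomp Require Import all_classical all_reals all_analysis.

Set Implicit Arguments.
Unset Strict Implicit.
Unset Printing Implicit Defensive.

Import Order.TTheory GRing.Theory Num.Theory.
Import numFieldNormedType.Exports.

Local Open Scope classical_set_scope.
Local Open Scope ring_scope.

(** Write [v] for the step at [x], [g] for the gradient at the new point
[x - v], and [lam] for the step parameter.  Since [v + lam H v = lam grad f x],
the second-order Taylor bound for the gradient gives [|lam g - v| <=
sigma_u |v|]: the step is an inexact proximal step with relative error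
[sigma_u].  Expanding that square and using the arithmetic-geometric mean
inequality together with the lower bound [theta = 2 sigma_l / L] on [lam |v|]
yields [<g, v> ^ 2 >= (1 - sigma_u) theta |g| ^ 3] ([hpe_decrease]), and by
convexity [f] decreases by at least [<g, v>] ([prox_newton_decrease]).

Let [beta k = f (x k) - f xbar].  Convexity and the diameter bound give
[beta (k + 1) <= |g| D0], so that the decrease becomes the recursion
[beta k - beta (k + 1) >= kappa0 beta (k + 1) ^ (3/2)].  In terms of
[s k = sqrt (beta k)], each step then raises [1 / s] by at least
[kappa0 / C], where [C = 2 + 3 kappa0 s 0] ([inv_growth]); hence
[k kappa0 s k < C], which is (a).

For (b), if the gradient stayed above [eps] up to index [2 N], each of the
steps from [N] to [2 N] would decrease [f] by more than
[sqrt ((1 - sigma_u) theta eps ^ 3)], while only [beta N < (C / (kappa0 N)) ^ 2]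
is available.  This bounds [N ^ 6] by a quantity 64 times smaller than [J ^ 6]
([small_term_of_decay]), which fails for [N = ceil J].

Two facts of Hilbert space theory support the argument: the Riesz
representation theorem, without which [gradient] would carry no information,
and the passage from the supremum [opnorm] to pointwise bounds.  The Newton
equation is read off the step itself: its value is 0 when the right-hand side is
outside of the range of [I + lam H], so that a nonzero step solves it
([newton_step_eq]). *)

(** * Inner products and the Riesz representation theorem *)

Section InnerProduct.
Context {R : realType} {H : completeNormedModType R}.
Variable dot : {dot H for @idfun R}.
Hypothesis dotE : hilbert_norm dot.

Implicit Types u v w : H.

Lemma dotC u v : dot u v = dot v u.
Proof. by rewrite hermC /= expr0 mul1r. Qed.

Lemma dotDr u v w : dot u (v + w) = dot u v + dot u w.
Proof. exact: linearD. Qed.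

Lemma dotZr (a : R) u v : dot u (a *: v) = a * dot u v.
Proof. exact: linearZ. Qed.

Lemma dotNr u v : dot u (- v) = - dot u v.
Proof. exact: raddfN. Qed.

Lemma dotDl u v w : dot (v + w) u = dot v u + dot w u.
Proof. by rewrite !(dotC _ u) dotDr. Qed.

Lemma dotNl u v : dot (- v) u = - dot v u.
Proof. by rewrite !(dotC _ u) dotNr. Qed.

Lemma dotZl (a : R) u v : dot (a *: v) u = a * dot v u.
Proof. by rewrite !(dotC _ u) dotZr. Qed.

Definition dot_lin := (dotDl, dotDr, dotNl, dotNr, dotZl, dotZr).

Lemma sqr_normD u v : `|u + v| ^+ 2 = `|u| ^+ 2 + 2 * dot u v + `|v| ^+ 2.
Proof. by rewrite !dotE !dot_lin (dotC v u); ring. Qed.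

Lemma sqr_normB u v : `|u - v| ^+ 2 = `|u| ^+ 2 - 2 * dot u v + `|v| ^+ 2.
Proof. by rewrite !dotE !dot_lin (dotC v u); ring. Qed.

Lemma cauchy_schwarz u v : dot u v <= `|u| * `|v|.
Proof.
have [->|u0] := eqVneq u 0; first by rewrite normr0 mul0r linear0l.
have [->|v0] := eqVneq v 0; first by rewrite normr0 mulr0 linear0.
have nu : 0 < `|u| by rewrite normr_gt0.
have nv : 0 < `|v| by rewrite normr_gt0.
have := sqr_ge0 `| `|v| *: u - `|u| *: v |.
rewrite sqr_normB !normrZ !normr_id !dot_lin => h.
have : 0 <= (2 * (`|u| * `|v|)) * (`|u| * `|v| - dot u v) by nra.
by rewrite pmulr_rge0 ?subr_ge0// mulr_gt0// mulr_gt0.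
Qed.

Lemma norm_dot_le u v : `|dot u v| <= `|u| * `|v|.
Proof.
rewrite ler_norml cauchy_schwarz andbT lerNl -dotNl.
by rewrite (le_trans (cauchy_schwarz _ _))// normrN.
Qed.

(** The functional [E u = |u| ^ 2 / 2 - phi u] has a minimizer: by the
parallelogram law every minimizing sequence is Cauchy.  At a minimizer [g] the
derivative of [E], which is [dot g - phi], vanishes. *)
Lemma riesz_representation (phi : {linear H -> R^o}) :
  continuous phi -> exists g, forall h, phi h = dot g h.
Proof.
move=> phic.
have [M M0 phiM] := linear_lipschitz phic.
have phiD u v : phi (u + v) = phi u + phi v :> R by rewrite linearD.
have phiZ (a : R) u : phi (a *: u) = a * phi u :> R by rewrite linearZ.
pose E u : R := `|u| ^+ 2 / 2 - phi u.
have Elb u : - (M ^+ 2 / 2) <= E u.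
  have := le_trans (ler_norm _) (phiM u); rewrite /E => pu.
  have := sqr_ge0 (`|u| - M); nra.
pose m := inf (range E).
have hinf : has_inf (range E).
  by split; [exists (E 0), 0 | exists (- (M ^+ 2 / 2)) => _ [u _ <-]].
have mE u : m <= E u by apply: ge_inf; [case: hinf | exists u].
have /choice [u uE] (n : nat) : exists u, E u < m + n.+1%:R^-1.
  have n0 : 0 < n.+1%:R^-1 :> R by rewrite invr_gt0.
  have [_ [v _ <-] vlt] := inf_adherent n0 hinf.
  by exists v.
have midpoint v w : `|v - w| ^+ 2 = 4 * (E v + E w - 2 * E (2^-1 *: (v + w))).
  rewrite /E phiZ phiD normrZ ger0_norm ?invr_ge0//.
  by rewrite exprMn sqr_normB sqr_normD; field.
have uc : cvg (u @ \oo).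
  apply/cauchy_cvgP/cauchy_exP => e e0.
  pose N := Num.truncn (8 / e ^+ 2); exists (u N).
  exists N => // n /= Nn; rewrite -ball_normE /ball_ /=.
  rewrite -(@ltr_pXn2r _ 2)// ?nnegrE ?normr_ge0// ?ltW//.
  rewrite midpoint.
  have hN : 8 * N.+1%:R^-1 < e ^+ 2.
    rewrite ltr_pdivrMr// mulrC -ltr_pdivrMr ?exprn_gt0//.
    exact: truncnS_gt.
  have hn : n.+1%:R^-1 <= N.+1%:R^-1 :> R.
    by rewrite lef_pV2 ?posrE// ler_nat.
  have := uE n; have := uE N; have := mE (2^-1 *: (u N + u n)).
  move: (N.+1%:R^-1 : R) (n.+1%:R^-1 : R) (E _) (E _) (E _) hN hn => a b p q r.
  lra.
pose g := lim (u @ \oo).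
have Eg : E g <= m.
  have Eu : (fun n => E (u n)) @ \oo --> E g.
    apply: cvgB.
      under eq_fun do rewrite expr2.
      by rewrite expr2; apply: cvgMr_tmp; apply: cvgM; exact: cvg_norm.
    by apply: (cvg_comp _ _ uc); exact: phic.
  have mu : (fun n => m + n.+1%:R^-1) @ \oo --> m.
    by rewrite -[X in _ --> X]addr0; apply: cvgD; [exact: cvg_cst|exact: cvg_harmonic].
  by apply: (ler_cvg_to Eu mu); near=> n; exact/ltW/uE.
exists g => h.
have key t : 0 <= t * (dot g h - phi h) + t ^+ 2 * (`|h| ^+ 2 / 2).
  have := le_trans Eg (mE (g + t *: h)).
  rewrite /E sqr_normD phiD phiZ normrZ exprMn real_normK ?num_real//.
  by rewrite dotZr; lra.
apply/eqP; rewrite eq_sym -subr_eq0; apply/eqP.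
set d := dot g h - phi h in key *.
have [/eqP|h0] := eqVneq h 0.
  by move=> /eqP h0; rewrite /d h0 linear0 (linear0 phi); exact: subrr.
have hh : 0 < `|h| ^+ 2 by rewrite exprn_gt0// normr_gt0.
(* The value of [t] that minimizes the quadratic of [key]. *)
have := key (- d / `|h| ^+ 2).
rewrite (_ : _ + _ = - (d ^+ 2 / (2 * `|h| ^+ 2))); last first.
  by field; rewrite normr_eq0.
rewrite oppr_ge0 pmulr_lle0; last by rewrite invr_gt0 pmulr_rgt0.
move=> d2.
by apply/eqP; rewrite -sqrf_eq0 eq_le d2 sqr_ge0.
Unshelve. all: by end_near. Qed.

End InnerProduct.

(** * Convexity and Taylor expansion *)

Section Calculus.
Context {R : realType} {H : completeNormedModType R}.
Variable dot : {dot H for @idfun R}.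
Hypothesis dotE : hilbert_norm dot.

Implicit Types (u v w : H) (f : H -> R).

(** [gradient] is a choice among representatives of the differential; the Riesz
theorem supplies one to choose. *)
Lemma gradientE f x : differentiable f x ->
  forall h, 'd f x h = dot (gradient dot f x) h.
Proof.
move=> df.
have [g gE] := riesz_representation dotE (diff_continuous df).
by apply: (@xgetPex _ _ [set g : H | forall h, 'd f x h = dot g h]); exists g.
Qed.

(** On the segment from [x] to [y] the difference quotient of a convex function
at [x] is at most [f y - f x], and so is its limit. *)
Lemma convex_above_tangent f x y :
  convex_function [set: H] f -> differentiable f x ->
  f x + dot (gradient dot f x) (y - x) <= f y.
Proof.
move=> fconv df; rewrite -gradientE// -deriveE// -lerBrDl.
have /cvg_dnbhs_at_right dlim := @diff_derivable _ _ _ f x (y - x) df.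
apply: (cvgr_to_le dlim); near=> t.
have t0 : 0 < t by [].
have t1 : t <= 1 by near: t; exact: nbhs_right_le.
have := fconv (Itv01 (ltW t0) t1) y x (mem_setT _) (mem_setT _).
rewrite convRE /= => h; rewrite [_ *: _]/(_ * _) ler_pdivrMl//=.
suff -> : t *: (y - x) + x = conv (Itv01 (ltW t0) t1)
    (y : convex_lmodType H) (x : convex_lmodType H).
  by rewrite /unstable.onem in h; lra.
rewrite /conv /= /unstable.onem scalerBl scale1r scalerBr -addrA.
by congr (_ + _); rewrite addrC.
Unshelve. all: by end_near. Qed.

Lemma dot_cvg T (F : set_system T) {FF : Filter F} (u : T -> H) l w :
  u t @[t --> F] --> l -> dot w (u t) @[t --> F] --> (dot w l : R).
Proof.
move=> ul; apply/cvgrPdist_lt => e e0; near=> t.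
have w0 : 0 < `|w| + 1 by rewrite ltr_wpDl.
have lt : `|l - u t| < e / (`|w| + 1).
  by near: t; apply: cvgr_dist_lt => //; rewrite divr_gt0.
rewrite -dotNr -dotDr; apply: (le_lt_trans (norm_dot_le dotE _ _)).
move: lt; rewrite ltr_pdivlMr// mulrC => lt; apply: le_lt_trans lt.
by rewrite ler_wpM2r// lerDl.
Unshelve. all: by end_near. Qed.

(** A bound [M] makes the set of values [|T v|] over the unit ball bounded, so
that its real supremum is an upper bound; the rest is scaling. *)
Lemma le_opnorm (T : H -> H) (M : R) :
  (forall a v, T (a *: v) = a *: T v) -> (forall v, `|T v| <= M * `|v|) ->
  forall v, `|T v| <= opnorm T * `|v|.
Proof.
move=> TZ TM v.
have [->|v0] := eqVneq v 0.
  by rewrite -[in leLHS](scale0r 0) TZ scale0r !normr0 mulr0.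
have nv : 0 < `|v| by rewrite normr_gt0.
rewrite -ler_pdivrMr//; apply: ub_le_sup.
  exists `|M| => _ [w /= w1 <-]; apply: (le_trans (TM w)).
  apply: (le_trans (ler_wpM2r (normr_ge0 _) (ler_norm M))).
  by rewrite ler_piMr.
exists (`|v|^-1 *: v).
  by rewrite /= normrZ ger0_norm ?invr_ge0// mulVf// gt_eqF.
by rewrite TZ normrZ ger0_norm ?invr_ge0// mulrC.
Qed.

Lemma is_derive_dot_line (g : H -> H) (x h w : H) (t : R) :
  differentiable g (x + t *: h) ->
  is_derive t 1 (fun s => dot w (g (x + s *: h))) (dot w ('d g (x + t *: h) h)).
Proof.
move=> dg.
suff qlim : (fun k : R => k^-1 *: (dot w (g (x + (k *: 1 + t) *: h))
    - dot w (g (x + t *: h)))) @ 0^' --> (dot w ('d g (x + t *: h) h) : R).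
  by split; [apply/cvg_ex; exists (dot w ('d g (x + t *: h) h)) | apply: cvg_lim].
rewrite -deriveE//.
have /(_ _) hlim := dot_cvg (w:=w) (@diff_derivable _ _ _ g _ h dg).
apply: (cvg_trans _ hlim).
apply: near_eq_cvg; near=> k => /=.
rewrite dotZr dotDr dotNr [_ *: (_ - _)]/(_ * _) [k *: 1]mulr1 scalerDl.
by rewrite [k *: h + _]addrC -addrA [t *: h + _]addrC.
Unshelve. all: by end_near. Qed.

(** The mean value theorem holds for scalar functions only, so the remainder
[r] is paired with itself.  Along the segment, [psi t] is the pairing of [r]
with [g (x + t h) - t 'd g x h], minus the bound [t ^ 2 L / 2 |h| ^ 2 |r|]
that it should respect; the Lipschitz condition makes its derivative
nonpositive, and [psi 1 <= psi 0] is the claim multiplied by [|r|]. *)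
Lemma lipschitz_diff_taylor (g : H -> H) (L : R) (x h : H) :
  (forall y, differentiable g y) ->
  (forall y v, `|'d g y v - 'd g x v| <= L * `|y - x| * `|v|) ->
  `|g (x + h) - g x - 'd g x h| <= L / 2 * `|h| ^+ 2.
Proof.
move=> dg gL; set r := g (x + h) - g x - 'd g x h.
have [->|r0] := eqVneq r 0.
  have := gL (x + h) h; rewrite [x + h]addrC addrK normr0 => hL.
  suff: 0 <= L * `|h| * `|h| by rewrite -mulrA -expr2 => ?; lra.
  exact: le_trans hL.
have nr : 0 < `|r| by rewrite normr_gt0.
pose psi (t : R) : R :=
  dot r (g (x + t *: h)) - (dot r ('d g x h) * t + L / 2 * `|h| ^+ 2 * `|r| * t ^+ 2).
pose dpsi (t : R) : R :=
  dot r ('d g (x + t *: h) h) - (dot r ('d g x h) + L / 2 * `|h| ^+ 2 * `|r| * (2 * t)).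
have psid (t : R) : is_derive t 1 psi (dpsi t).
  apply: is_deriveB; first exact: is_derive_dot_line.
  apply: is_deriveD.
    have := is_deriveZ (dot r ('d g x h)) (is_derive_id t (1 : R)).
    by rewrite [_ *: 1]mulr1; apply.
  have := is_deriveZ (L / 2 * `|h| ^+ 2 * `|r|)
    (is_deriveX 2 (is_derive_id t (1 : R))).
  by rewrite [_ *: 1]mulr1; apply.
have psic : {within `[0, 1], continuous psi}.
  apply: derivable_within_continuous => t _.
  by have [] := psid t.
have [c /andP[c0 c1] cE] := MVT ltr01 (fun t _ => psid t) psic.
rewrite bnd_simp in c0.
have dle : dpsi c <= 0.
  have := gL (x + c *: h) h.
  rewrite [x + _]addrC addrK normrZ gtr0_norm// => hL.
  have := cauchy_schwarz dotE r ('d g (c *: h + x) h - 'd g x h).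
  rewrite dotDr dotNr /dpsi [x + _]addrC => cs.
  have := ler_wpM2l (normr_ge0 r) hL.
  nra.
have : psi 1 - psi 0 <= 0 by rewrite cE subr0 mulr1.
rewrite /psi scale1r scale0r addr0 => h1.
have : dot r r = dot r (g (x + h)) - dot r (g x) - dot r ('d g x h).
  by rewrite {2}/r !dotDr !dotNr.
rewrite -dotE => h2.
rewrite -(ler_pM2l nr) -expr2; nra.
Qed.

End Calculus.

(** * One proximal-Newton step *)

(** Outside of the range a partial inverse takes its default value.  For
[newton_step] this default is 0, so a nonzero step solves the Newton equation. *)
Lemma pinv_notin T U (dflt : U -> T) (A : set T) (F : T -> U) (y : U) :
  ~ (F @` A) y -> 'pinv_dflt A F y = dflt y.
Proof.
by move=> nFy; rewrite /pinv_ splitV oinv_surj; case: pselect.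
Qed.

Lemma newton_step_eq (R : realType) (H : completeNormedModType R)
    (dot : {dot H for @idfun R}) (f : H -> R) (lam : R) (x : H) :
  let v := newton_step dot f lam x in
  v != 0 -> v + lam *: hessian dot f x v = lam *: gradient dot f x.
Proof.
rewrite /= /newton_step; set F := (fun v : H => _); set b := lam *: _ => v0.
have [[u _ <-]|nb] := pselect ((F @` [set: H]) b).
  by rewrite -[LHS]/(F _) pinvK//; apply/mem_set; exists u.
by rewrite pinv_notin// eqxx in v0.
Qed.

Section HPE.
Context {R : realType} {H : completeNormedModType R}.
Variable dot : {dot H for @idfun R}.
Hypothesis dotE : hilbert_norm dot.

(** Expanding the relative-error bound gives
[2 lam <g, v> >= (lam |g|) ^ 2 + (1 - sigma ^ 2) |v| ^ 2].  The
arithmetic-geometric mean inequality turns this into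
[<g, v> ^ 2 >= (1 - sigma ^ 2) |g| ^ 2 |v| ^ 2], where [lam] has cancelled;
one factor [|v| ^ 2] is traded for [theta |g|] through
[lam |g| <= (1 + sigma) |v|] and [theta <= lam |v|]. *)
Lemma hpe_decrease (g v : H) (lam sigma theta : R) :
  0 < lam -> 0 <= sigma < 1 ->
  `|lam *: g - v| <= sigma * `|v| -> theta <= lam * `|v| ->
  0 <= dot g v /\ (1 - sigma) * theta * `|g| ^+ 3 <= dot g v ^+ 2.
Proof.
move=> l0 /andP[s0 s1] res large.
have a0 := normr_ge0 g; have n0 := normr_ge0 v.
have sq : (lam * `|g|) ^+ 2 + (1 - sigma ^+ 2) * `|v| ^+ 2 <= 2 * lam * dot g v.
  have : `|lam *: g - v| ^+ 2 <= (sigma * `|v|) ^+ 2.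
    by rewrite ler_pXn2r// nnegrE// mulr_ge0.
  by rewrite (sqr_normB dotE) dotZl normrZ gtr0_norm// !exprMn; lra.
have tri : lam * `|g| <= (1 + sigma) * `|v|.
  have := ler_normD (lam *: g - v) v.
  by rewrite subrK normrZ gtr0_norm//; lra.
move: `|g| `|v| (dot g v) a0 n0 sq tri large => a n p a0 n0 sq tri large {res}.
have s2 : 0 <= 1 - sigma ^+ 2 by nra.
have sn0 : 0 <= (1 - sigma ^+ 2) * n ^+ 2 by rewrite mulr_ge0 ?sqr_ge0.
have p0 : 0 <= p.
  have : 0 <= 2 * lam * p by apply: le_trans sq; rewrite addr_ge0 ?sqr_ge0.
  by rewrite pmulr_rge0// mulr_gt0.
split=> //.
have amgm : (1 - sigma ^+ 2) * a ^+ 2 * n ^+ 2 <= p ^+ 2.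
  have h1 : 4 * ((lam * a) ^+ 2 * ((1 - sigma ^+ 2) * n ^+ 2)) <= (2 * lam * p) ^+ 2.
    apply: (@le_trans _ _ (((lam * a) ^+ 2 + (1 - sigma ^+ 2) * n ^+ 2) ^+ 2)).
      have := sqr_ge0 ((lam * a) ^+ 2 - (1 - sigma ^+ 2) * n ^+ 2); nra.
    rewrite ler_pXn2r// nnegrE ?addr_ge0 ?sqr_ge0//.
    by rewrite mulr_ge0// mulr_ge0// ltW.
  have l2 : 0 < 4 * lam ^+ 2 by rewrite mulr_gt0// exprn_gt0.
  by rewrite -(ler_pM2l l2); move: h1; rewrite !exprMn; lra.
have an : theta * a <= (1 + sigma) * n ^+ 2.
  apply: (@le_trans _ _ (lam * n * a)); first by rewrite ler_wpM2r.
  by rewrite mulrAC expr2 mulrA ler_wpM2r.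
apply: le_trans amgm.
have -> : (1 - sigma ^+ 2) * a ^+ 2 * n ^+ 2
  = (1 - sigma) * a ^+ 2 * ((1 + sigma) * n ^+ 2) by ring.
have -> : (1 - sigma) * theta * a ^+ 3 = (1 - sigma) * a ^+ 2 * (theta * a) by ring.
by rewrite ler_wpM2l// mulr_ge0 ?sqr_ge0//; lra.
Qed.

End HPE.

Section Newton.
Context {R : realType} {H : completeNormedModType R}.
Variable dot : {dot H for @idfun R}.
Hypothesis dotE : hilbert_norm dot.

(** The differentials are continuous, hence bounded, so that the operator norm of
their difference controls it pointwise. *)
Lemma hessian_lipschitzP (f : H -> R) (L : R) :
  (forall x, differentiable (gradient dot f) x) -> lipschitz_hessian dot L f ->
  forall x y v, `|hessian dot f y v - hessian dot f x v| <= L * `|y - x| * `|v|.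
Proof.
move=> dg Lip x y v.
have [M1 _ h1] := linear_lipschitz (diff_continuous (dg y)).
have [M2 _ h2] := linear_lipschitz (diff_continuous (dg x)).
apply: le_trans (ler_wpM2r (normr_ge0 v) (Lip y x)).
apply: (@le_opnorm _ _ (hessian dot f y \- hessian dot f x) (M1 + M2)).
  move=> a w /=.
  by rewrite [hessian dot f y _]linearZ [hessian dot f x _]linearZ scalerBr.
by move=> w /=; rewrite (le_trans (ler_normB _ _))// mulrDl lerD.
Qed.

(** The Newton equation identifies [lam *: g - v] with [lam] times the Taylor
remainder of the gradient, which is at most [lam L / 2 |v| ^ 2]; the upper
bound on [lam |v|] makes it at most [sigma_u |v|]. *)
Lemma prox_newton_decrease (f : H -> R) (L sigma_l sigma_u lam : R) (x : H) :
  convex_function [set: H] f -> twice_continuously_differentiable dot f ->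
  0 < L -> lipschitz_hessian dot L f -> 0 < sigma_l -> 0 < sigma_u < 1 -> 0 < lam ->
  let v := newton_step dot f lam x in
  2 * sigma_l / L <= lam * `|v| -> lam * `|v| <= 2 * sigma_u / L ->
  [/\ v != 0, f (x - v) <= f x &
    (1 - sigma_u) * (2 * sigma_l / L) * `|gradient dot f (x - v)| ^+ 3
      <= (f x - f (x - v)) ^+ 2].
Proof.
move=> fconv [df dg _] L0 Lip sl0 /andP[su0 su1] l0 v lo hi.
have v0 : v != 0.
  apply/eqP => v0; move: lo; rewrite v0 normr0 mulr0 leNgt.
  by rewrite divr_gt0// mulr_gt0.
have eqv := newton_step_eq v0; rewrite -/v in eqv.
set g := gradient dot f (x - v).
have res : `|lam *: g - v| <= sigma_u * `|v|.
  have := lipschitz_diff_taylor dotE (- v) dg (hessian_lipschitzP dg Lip x).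
  rewrite normrN -/g linearN opprK => tay.
  have -> : lam *: g - v = lam *: (g - gradient dot f x + 'd (gradient dot f) x v).
    by rewrite scalerDr scalerBr -eqv opprD addrA subrK.
  rewrite normrZ gtr0_norm//.
  apply: le_trans (ler_wpM2l (ltW l0) tay) _.
  have -> : lam * (L / 2 * `|v| ^+ 2) = L / 2 * (lam * `|v|) * `|v| by ring.
  rewrite ler_wpM2r//.
  have -> : sigma_u = L / 2 * (2 * sigma_u / L) by field; rewrite gt_eqF.
  by rewrite ler_wpM2l// divr_ge0// ltW.
have su01 : 0 <= sigma_u < 1 by rewrite ltW.
have [p0 ple] := hpe_decrease dotE l0 su01 res lo.
have := convex_above_tangent dotE x fconv (df (x - v)).
rewrite -/g subKr => fle.
have dec : dot g v <= f x - f (x - v) by lra.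
split=> //; first by lra.
by apply: le_trans ple _; rewrite ler_pXn2r// nnegrE (le_trans p0).
Qed.

End Newton.

(** * Decay rates of real sequences *)

(** With [y = kappa b], the hypothesis reads [a ^ 2 >= b ^ 2 (1 + y)], and
[(1 + y) (2 + 2 y) ^ 2 >= (2 + 3 y) ^ 2] then gives
[a >= b (2 + 3 y) / (2 + 2 y)], whose inverse form is the conclusion. *)
Lemma inv_increment (R : realFieldType) (kappa a b : R) :
  0 < kappa -> 0 < a -> 0 < b -> kappa * b ^+ 3 <= a ^+ 2 - b ^+ 2 ->
  a^-1 + kappa / (2 + 3 * kappa * b) <= b^-1.
Proof.
move=> k0 a0 b0 ab.
have y0 : 0 < kappa * b by rewrite mulr_gt0.
have d1 : 0 < 2 + 3 * (kappa * b) by lra.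
have d2 : 0 < 2 + 2 * (kappa * b) by lra.
have h : b * (2 + 3 * (kappa * b)) <= a * (2 + 2 * (kappa * b)).
  rewrite -(@ler_pXn2r _ 2)//; try by rewrite nnegrE ltW// mulr_gt0.
  rewrite !exprMn.
  have a2 : b ^+ 2 * (1 + kappa * b) <= a ^+ 2 by lra.
  apply: (@le_trans _ _ (b ^+ 2 * (1 + kappa * b) * (2 + 2 * (kappa * b)) ^+ 2)).
    rewrite -[leRHS]mulrA ler_wpM2l ?sqr_ge0//.
    have := exprn_ge0 3 (ltW y0); have := sqr_ge0 (kappa * b); nra.
  by rewrite ler_wpM2r// sqr_ge0.
have -> : b^-1 = (2 + 2 * (kappa * b)) / (b * (2 + 3 * (kappa * b)))
   + kappa / (2 + 3 * kappa * b).
  by field; rewrite ?gt_eqF//; rewrite -mulrA.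
by rewrite lerD2r ler_pdivlMr ?mulr_gt0// ler_pdivrMl.
Qed.

(** The recursion is a discrete version of [beta' = - kappa beta ^ (3/2)] for
[beta = s ^ 2], whose solutions have [1 / s] affine in time. *)
Lemma inv_growth (R : realFieldType) (kappa : R) (s : nat -> R) :
  0 < kappa -> (forall k, 0 < s k) ->
  (forall k, kappa * s k.+1 ^+ 3 <= s k ^+ 2 - s k.+1 ^+ 2) ->
  forall k, (s 0%N)^-1 + k%:R * (kappa / (2 + 3 * kappa * s 0%N)) <= (s k)^-1.
Proof.
move=> k0 s0 sS.
have den k : 0 < 2 + 3 * kappa * s k.
  by rewrite addr_gt0// mulr_gt0// mulr_gt0.
have dec k : s k.+1 <= s k.
  rewrite -lef_pV2 ?posrE// (le_trans _ (inv_increment k0 (s0 _) (s0 _) (sS k)))//.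
  by rewrite lerDl divr_ge0// ltW.
have bnd k : s k <= s 0%N by elim: k => // k IH; exact: le_trans (dec k) IH.
elim=> [|k IH]; first by rewrite mul0r addr0.
apply: le_trans (inv_increment k0 (s0 _) (s0 _) (sS k)).
rewrite -natr1 mulrDl mul1r addrA lerD//.
rewrite ler_wpM2l ?(ltW k0)// lef_pV2 ?posrE//.
by rewrite lerD2l ler_wpM2l// mulr_ge0// ltW.
Qed.

Lemma telescope_ge (R : numDomainType) (b : nat -> R) (c : R) (m n : nat) :
  (forall k, (k < m + n)%N -> c <= b k - b k.+1) -> n%:R * c <= b m - b (m + n)%N.
Proof.
elim: n => [|n IH] h; first by rewrite mul0r addn0 subrr.
rewrite -natr1 mulrDl mul1r addnS.
have -> : b m - b (m + n).+1 = (b m - b (m + n)%N) + (b (m + n)%N - b (m + n).+1).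
  by rewrite addrA subrK.
by rewrite lerD ?h ?addnS// IH// => k kn; apply: h; rewrite addnS ltnS ltnW.
Qed.

Lemma powR_frac_exprn (R : realType) (a p : R) (m n : nat) : 0 <= a ->
  p * m%:R = n%:R -> (a `^ p) ^+ m = a ^+ n.
Proof. by move=> a0 pm; rewrite -powR_mulrn ?powR_ge0// -powRrM pm powR_mulrn. Qed.

(** A sequence [s ^ 2] of size [(C / (kappa N)) ^ 2] at time [N] cannot afford [N]
further decreases larger than [c = sqrt (Q eps ^ 3)]. The sixth power in the
condition on [N] clears the cube and square roots of the natural threshold. *)
Lemma small_term_of_decay (R : realType) (kappa C Q eps : R) (s a : nat -> R)
    (N : nat) :
  0 < kappa -> 0 < C -> 0 < Q -> 0 < eps -> (forall k, 0 <= s k) ->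
  (forall k, s k.+1 ^+ 2 <= s k ^+ 2) ->
  (forall k, Q * a k.+1 ^+ 3 <= (s k ^+ 2 - s k.+1 ^+ 2) ^+ 2) ->
  N%:R * kappa * s N <= C ->
  C ^+ 4 < N%:R ^+ 6 * (kappa ^+ 4 * Q * eps ^+ 3) ->
  exists2 j, (j <= N + N)%N & a j <= eps.
Proof.
move=> kappa0 C0 Q0 eps0 s0 mono dec sN CN; apply: contrapT => no.
pose c := Num.sqrt (Q * eps ^+ 3).
have c0 : 0 <= c by exact: sqrtr_ge0.
have c2 : c ^+ 2 = Q * eps ^+ 3 by rewrite sqr_sqrtr// mulr_ge0 ?exprn_ge0// ltW.
have sum : N%:R * c <= s N ^+ 2 - s (N + N)%N ^+ 2.
  apply: (@telescope_ge _ (fun k => s k ^+ 2)) => k kN.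
  rewrite -(@ler_pXn2r _ 2)// ?nnegrE ?subr_ge0// c2; apply: le_trans (dec k).
  have large : eps <= a k.+1.
    by rewrite leNgt; apply/negP => small; apply: no; exists k.+1; last exact: ltW.
  by rewrite ler_pM2l// ler_pXn2r// nnegrE ?(ltW eps0)// (le_trans (ltW eps0)).
have sNc : N%:R * c <= s N ^+ 2 by have := sqr_ge0 (s (N + N)%N); lra.
have h1 : (N%:R * c) ^+ 2 <= (s N ^+ 2) ^+ 2.
  by rewrite ler_pXn2r// nnegrE ?sqr_ge0 ?mulr_ge0.
have h2 : (N%:R * kappa * s N) ^+ 4 <= C ^+ 4.
  by rewrite ler_pXn2r// nnegrE ?(ltW C0)// !mulr_ge0// ltW.
suff : N%:R ^+ 6 * (kappa ^+ 4 * Q * eps ^+ 3) <= C ^+ 4 by rewrite leNgt CN.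
apply: le_trans h2.
have -> : N%:R ^+ 6 * (kappa ^+ 4 * Q * eps ^+ 3)
    = (N%:R * kappa) ^+ 4 * (N%:R * c) ^+ 2 by rewrite -(mulrA _ Q) -c2; ring.
rewrite [leRHS]exprMn ler_wpM2l ?exprn_ge0 ?mulr_ge0 ?(ltW kappa0)//.
by rewrite -exprM in h1.
Qed.

(** * Iteration complexity *)

Lemma le_sublevel_diam (R : realType) (H : completeNormedModType R)
    (f : H -> R) (x0 y z : H) :
  (sublevel_diam f x0 < +oo)%E -> f y <= f x0 -> f z <= f x0 ->
  `|z - y| <= fine (sublevel_diam f x0).
Proof.
move=> Dfin fy fz; rewrite -lee_fin fineK.
  by apply: ereal_sup_ubound; exists (y, z) => //=; rewrite ge_max fy fz.
rewrite ge0_fin_numE//; apply: le_trans (ereal_sup_ubound _).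
  exact: (@lexx _ _ 0%E).
by exists (x0, x0); rewrite /= ?subrr ?normr0 ?ge_max ?lexx.
Qed.

Theorem theorem7p5 (R : realType) (H : completeNormedModType R)
  (dot : {dot H for @idfun R}) (f : H -> R) (L sigma_l sigma_u : R)
  (x0 xbar : H) (lam : nat -> R) (x : nat -> H) (eps : R) :
  hilbert_norm dot ->
  convex_function [set: H] f ->
  twice_continuously_differentiable dot f ->
  0 < L ->
  lipschitz_hessian dot L f ->
  minimizer f xbar ->
  0 < sigma_l -> sigma_l < sigma_u -> sigma_u < 1 ->
  (sublevel_diam f x0 < +oo)%E ->
  prox_newton_run dot f L sigma_l sigma_u x0 lam x ->
  0 < eps ->
  let D0 := fine (sublevel_diam f x0) in
  let kappa0 := Num.sqrt (2 * sigma_l * (1 - sigma_u) / (L * D0 ^+ 3)) in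
  let K := (2 + 3 * kappa0 * Num.sqrt (f x0 - f xbar))
           / (kappa0 * Num.sqrt eps) in
  let J := 2 * L `^ (1 / 6)
             * (2 + 3 * kappa0 * Num.sqrt (f x0 - f xbar)) `^ (2 / 3)
           / ((2 * sigma_l * (1 - sigma_u)) `^ (1 / 6)
              * kappa0 `^ (2 / 3) * Num.sqrt eps) in
  (forall k : nat, K <= k%:R -> f (x k) - f xbar <= eps) /\
  (exists j : nat, (j%:Z <= 2 * Num.ceil J)%R /\ `|gradient dot f (x j)| <= eps).
Proof.
move=> dotE fconv f2 L0 Lip xmin sl0 slu su1 Dfin [x0E run] eps0 D0 kappa0.
have [df _ _] := f2.
set C := 2 + 3 * kappa0 * _; move=> K J.
have su0 : 0 < sigma_u by exact: lt_trans slu.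
set Q := (1 - sigma_u) * (2 * sigma_l / L).
have Q0 : 0 < Q by rewrite !mulr_gt0 ?invr_gt0 ?subr_gt0.
have step k : [/\ x k.+1 != x k, f (x k.+1) <= f (x k) &
    Q * `|gradient dot f (x k.+1)| ^+ 3 <= (f (x k) - f (x k.+1)) ^+ 2].
  have [_ l0 lo hi ->] := run k.
  have su01 : 0 < sigma_u < 1 by rewrite su0.
  have [v0 fle fdec] := prox_newton_decrease dotE fconv f2 L0 Lip sl0 su01 l0 lo hi.
  split=> //; apply: contra v0 => /eqP xv; apply/eqP.
  by rewrite -[LHS](subKr (x k)) xv subrr.
have mono k : f (x k) <= f x0.
  by elim: k => [|k IH]; [rewrite x0E|have [_ h _] := step k; exact: le_trans h IH].
have diam y z := @le_sublevel_diam _ _ f x0 y z Dfin; rewrite -/D0 in diam.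
(* The first step is nonzero and stays in the sublevel set. *)
have D00 : 0 < D0.
  have [x10 _ _] := step 0%N.
  by apply: lt_le_trans (diam _ _ (mono 0%N) (mono 1%N)); rewrite normr_gt0 subr_eq0.
pose beta k := f (x k) - f xbar.
have beta0 k : 0 <= beta k by rewrite subr_ge0.
have k2 : kappa0 ^+ 2 = Q / D0 ^+ 3.
  rewrite sqr_sqrtr.
    by rewrite /Q; field; rewrite !gt_eqF.
  by rewrite divr_ge0 ?mulr_ge0 ?exprn_ge0 ?subr_ge0 ?ltW.
have kappa_gt0 : 0 < kappa0.
  by rewrite sqrtr_gt0 divr_gt0 ?mulr_gt0 ?subr_gt0.
have betaS k : kappa0 ^+ 2 * beta k.+1 ^+ 3 <= (beta k - beta k.+1) ^+ 2.
  have -> : beta k - beta k.+1 = f (x k) - f (x k.+1) by rewrite /beta; ring.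
  have [_ _ fdec] := step k; apply: le_trans fdec.
  have bD : beta k.+1 <= `|gradient dot f (x k.+1)| * D0.
    have := convex_above_tangent dotE xbar fconv (df (x k.+1)).
    have := cauchy_schwarz dotE (- gradient dot f (x k.+1)) (xbar - x k.+1).
    rewrite normrN dotNl.
    have := ler_wpM2l (normr_ge0 (gradient dot f (x k.+1)))
      (diam _ _ (mono k.+1) (xmin x0)).
    by rewrite /beta; lra.
  rewrite k2 mulrAC ler_pdivrMr ?exprn_gt0// -[leRHS]mulrA -exprMn ler_wpM2l ?(ltW Q0)//.
  by rewrite ler_pXn2r// nnegrE // mulr_ge0// ltW.
(* The nonzero gradient at the next iterate forces a strict decrease. *)
have beta_gt0 k : 0 < beta k.
  have [_ fle fdec] := step k; have [gn0 _ _ _ _] := run k.+1.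
  apply: le_lt_trans (beta0 k.+1) _; rewrite ltrD2r lt_neqAle fle andbT.
  apply/eqP => fE; move: fdec; rewrite fE subrr expr0n leNgt.
  by rewrite mulr_gt0// exprn_gt0// normr_gt0; exact/eqP.
pose s k := Num.sqrt (beta k).
have s0 k : 0 < s k by rewrite sqrtr_gt0.
have s2 k : s k ^+ 2 = beta k by rewrite sqr_sqrtr.
have sS k : kappa0 * s k.+1 ^+ 3 <= s k ^+ 2 - s k.+1 ^+ 2.
  have [_ fle _] := step k.
  rewrite -(@ler_pXn2r _ 2)// ?nnegrE.
  - by rewrite !s2 exprMn -exprM mulnC exprM s2.
  - by rewrite mulr_ge0 ?exprn_ge0// ltW.
  - by rewrite !s2 /beta; lra.
have CE : C = 2 + 3 * kappa0 * s 0%N by rewrite /C /s /beta x0E.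
have C0 : 0 < C by rewrite CE addr_gt0// mulr_gt0// mulr_gt0.
have growth k : k%:R * kappa0 * s k < C.
  have := inv_growth kappa_gt0 s0 sS k; rewrite -CE => h.
  have : k%:R * (kappa0 / C) < (s k)^-1.
    by apply: lt_le_trans h; rewrite ltrDr invr_gt0.
  by rewrite mulrA ltr_pdivrMr// ltr_pdivlMl// mulrC.
have se0 : 0 < Num.sqrt eps by rewrite sqrtr_gt0.
split.
  move=> k; rewrite /K ler_pdivrMr ?(mulr_gt0 kappa_gt0)// => Kk.
  have k0 : (0 < k)%N.
    by case: k Kk => // ; rewrite mul0r leNgt C0.
  have : s k <= Num.sqrt eps.
    have := lt_le_trans (growth k) Kk; rewrite mulrA ltr_pM2l ?mulr_gt0 ?ltr0n//.
    exact: ltW.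
  by rewrite ler_sqrt// ltW.
have J0 : 0 < J.
  by rewrite divr_gt0// !mulr_gt0// powR_gt0// !mulr_gt0// subr_gt0.
pose N := `|Num.ceil J|%N.
have NE : N%:Z = Num.ceil J by rewrite gez0_abs// ceil_ge0 (lt_le_trans _ (ltW J0))// ltrN10.
have JN : J <= N%:R.
  by rewrite -[N%:R]/(N%:Z%:~R) NE; exact: ceil_ge.
have J6 : J ^+ 6 * (kappa0 ^+ 4 * Q * eps ^+ 3) = 64 * C ^+ 4.
  have A0 : 0 < 2 * sigma_l * (1 - sigma_u) by rewrite !mulr_gt0// subr_gt0.
  have root6 (a : R) : 0 < a -> (a `^ (1 / 6)) ^+ 6 = a.
    by move=> a0; rewrite (@powR_frac_exprn _ _ _ 6 1) ?(ltW a0)// mul1r mulVf.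
  have root3 (a : R) : 0 < a -> (a `^ (2 / 3)) ^+ 6 = a ^+ 4.
    by move=> a0; apply: powR_frac_exprn; [exact: ltW|field].
  have sqrt6 : Num.sqrt eps ^+ 6 = eps ^+ 3.
    by rewrite (exprM _ 2 3) sqr_sqrtr// ltW.
  rewrite /J expr_div_n !(exprMn 6).
  rewrite !root6// !root3// sqrt6 /Q; field.
  by rewrite !gt_eqF ?subr_gt0.
have CN : C ^+ 4 < N%:R ^+ 6 * (kappa0 ^+ 4 * Q * eps ^+ 3).
  apply: (@lt_le_trans _ _ (64 * C ^+ 4)).
    by have : 0 < C ^+ 4 by [rewrite exprn_gt0]; lra.
  rewrite -J6 ler_wpM2r//.
    exact: ltW (mulr_gt0 (mulr_gt0 (exprn_gt0 4 kappa_gt0) Q0) (exprn_gt0 3 eps0)).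
  by rewrite ler_pXn2r// nnegrE ?(ltW J0).
have [||k||j jN gj] := @small_term_of_decay R kappa0 C Q eps s
  (fun k => `|gradient dot f (x k)|) N kappa_gt0 C0 Q0 eps0 _ _ _ _ CN.
- by move=> k; exact: ltW.
- by move=> k; have [_ fle _] := step k; rewrite !s2 lerD2r.
- have [_ _ fdec] := step k; apply: le_trans fdec _.
  by rewrite !s2 /beta opprB addrA subrK.
- exact: ltW.
- by exists j; split; rewrite // -NE -[2]/(2%:Z) -PoszM mul2n -addnn lez_nat.
Qed.
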